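(* For every integer $k \ge 1$, $\mathrm{sdim}(GP(4k+2,2)) = 4k+2$.
   Context: Let $n,m$ be integers with $n \ge 3$ and $1 \le m < n/2$. The generalized Petersen graph $GP(n,m)$ is the simple undirected graph with vertex set $V = \{u_i, v_i \mid 0 \le i \le n-1\}$ ($2n$ vertices) and edge set $\{\{u_i,u_{i+1}\}, \{u_i,v_i\}, \{v_i,v_{i+m}\} \mid 0 \le i \le n-1\}$, where vertex indices are taken modulo $n$. Let $G$ be a simple connected undirected graph and let $d$ be its shortest-path distance. A vertex $w$ strongly resolves two vertices $u$ and $v$ if $u$ belongs to a shortest $v$–$w$ path or $v$ belongs to a shortest $u$–$w$ path (equivalently, $d(v,w) = d(v,u) + d(u,w)$ or $d(u,w) = d(u,v) + d(v,w)$). A vertex set $S$ of $G$ is a strong resolving set of $G$ if every two distinct vertices of $G$ are strongly resolved by some vertex of $S$. The strong metric dimension $\mathrm{sdim}(G)$ is the minimum cardinality of a strong resolving set of $G$. *)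

(* Defs.v *)
From mathcomp Require Import all_boot.

Set Implicit Arguments.
Unset Strict Implicit.
Unset Printing Implicit Defensive.

(* A simple graph is a symmetric irreflexive relation e on a finite type T.   *)
Section StrongMetricDimension.

Variables (T : finType) (e : rel T).

Definition walk_of_length (x y : T) (l : nat) : bool :=
  [exists p : l.-tuple T, path e x p && (last x p == y)].

(* When y is reachable from x some walk has length < #|T| (lemma gdistP);     *)
(* otherwise gdist x y takes the junk value #|T|.                             *)
Definition gdist (x y : T) : nat := find (walk_of_length x y) (iota 0 #|T|).

(* y belongs to some shortest x-z path; its vertices are x followed by p.     *)
Definition on_shortest_path (x y z : T) : bool :=
  [exists p : (gdist x z).-tuple T,
    [&& path e x p, last x p == z & y \in x :: p]].

Definition strongly_resolves (w u v : T) : bool :=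
  on_shortest_path v u w || on_shortest_path u v w.

Definition strong_resolving_set (S : {set T}) : bool :=
  [forall u, forall v, (u != v) ==> [exists w in S, strongly_resolves w u v]].

(* In a connected graph [set: T] is strong resolving (lemma                   *)
(* strong_resolving_setT), so the arg min is a genuine minimum (sdimP).       *)
Definition sdim : nat :=
  #|[arg min_(S < [set: T] | strong_resolving_set S) #|S| ]|.

Lemma gdistP x y : connect e x y ->
  walk_of_length x y (gdist x y) /\
  forall p, path e x p -> last x p = y -> gdist x y <= size p.
Proof.
move=> /connectP[p0 ep0 ->]; case: (shortenP ep0) => p ep up _.
have lt_p : size p < #|T|.
  by rewrite -[_.+1]/(size (x :: p)) -(card_uniqP up) max_card.
have walkS q : path e x q -> walk_of_length x (last x q) (size q).
  by move=> eq; apply/existsP; exists (in_tuple q); rewrite eq /=.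
have hasw : has (walk_of_length x (last x p)) (iota 0 #|T|).
  by apply/hasP; exists (size p); rewrite ?mem_iota // walkS.
split=> [|q eq lq].
  have := nth_find 0 hasw; rewrite nth_iota //.
  by move: hasw; rewrite has_find size_iota.
rewrite /gdist leqNgt; apply/negP => lt_q.
have := before_find 0 lt_q; rewrite nth_iota ?add0n; last first.
  by apply: leq_trans lt_q _; rewrite -[leqRHS](size_iota 0) find_size.
by rewrite -lq walkS.
Qed.

Lemma strong_resolving_setT :
  (forall x y, connect e x y) -> strong_resolving_set [set: T].
Proof.
move=> conn; apply/forallP => u; apply/forallP => v; apply/implyP => _.
apply/existsP; exists u; rewrite inE; apply/orP; left.
have [/existsP[p /andP[ep /eqP lp]] _] := gdistP (conn v u).
by apply/existsP; exists p; rewrite ep lp eqxx /=; have := mem_last v p; rewrite lp.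
Qed.

Lemma sdimP : (forall x y, connect e x y) ->
  (exists2 S : {set T}, strong_resolving_set S & #|S| = sdim) /\
  forall S : {set T}, strong_resolving_set S -> sdim <= #|S|.
Proof.
move=> conn; rewrite /sdim; case: arg_minnP => [|S resS minS].
  exact: strong_resolving_setT.
by split=> //; exists S.
Qed.

End StrongMetricDimension.

(* inl i is the outer vertex u_i and inr i the inner vertex v_i.              *)
Definition GP_arc (n m : nat) (x y : 'I_n + 'I_n) : bool :=
  match x, y with
  | inl i, inl j => val j == (i + 1) %% n
  | inl i, inr j => i == j
  | inr i, inr j => val j == (i + m) %% n
  | inr _, inl _ => false
  end.

Definition GP (n m : nat) : rel ('I_n + 'I_n) :=
  [rel x y | GP_arc m x y || GP_arc m y x].
Arguments GP : clear implicits.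

Lemma GP_sym n m : symmetric (GP n m).
Proof. by move=> x y; apply: orbC. Qed.

Lemma GP_irr n m : 2 < n -> 0 < m -> m.*2 < n -> irreflexive (GP n m).
Proof.
move=> n_gt2 m_gt0 lt_mn.
have neq k (i : 'I_n) : 0 < k < n -> (val i == (i + k) %% n) = false.
  case/andP=> k_gt0 lt_kn.
  have -> : (val i == (i + k) %% n) = (i + 0 == i + k %[mod n]).
    by rewrite addn0 (modn_small (ltn_ord i)).
  by rewrite eqn_modDl mod0n modn_small // eq_sym eqn0Ngt k_gt0.
have lt_m : m < n by apply: leq_ltn_trans lt_mn; rewrite -addnn leq_addr.
by case=> i; rewrite /GP /= orbb neq ?m_gt0 //= (ltn_trans _ n_gt2).
Qed.

Lemma GP_connected n m x y : connect (GP n m) x y.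
Proof.
have symc : connect_sym (GP n m) by apply: sym_connect_sym; apply: GP_sym.
case: n x y symc => [|n] x y symc; first by case: x => [[]|[]].
suff to0 z : connect (GP n.+1 m) (inl ord0) z.
  by apply: connect_trans (to0 y); rewrite symc.
have outer k (lt_k : k < n.+1) :
    connect (GP n.+1 m) (inl ord0) (inl (Ordinal lt_k)).
  elim: k lt_k => [|k IHk] lt_k.
    by apply: eq_connect0; congr inl; apply: val_inj.
  apply: connect_trans (IHk (ltnW lt_k)) (connect1 _).
  by rewrite /GP /= addn1 modn_small ?eqxx.
case: z => -[i lt_i]; first exact: outer.
by apply: connect_trans (outer i lt_i) (connect1 _); rewrite /GP /= eqxx.
Qed.

(* Main.v *)
Require Import Defs.
From mathcomp Require Import all_boot.
From mathcomp Require Import zify.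

Set Implicit Arguments.
Unset Strict Implicit.
Unset Printing Implicit Defensive.

(** Two vertices are mutually maximally distant when no neighbour of either
    one is farther from the other.  In a connected graph a set is strong
    resolving exactly when it meets every mutually maximally distant pair
    (Oellermann and Peters-Fransen), because only an endpoint can strongly
    resolve such a pair, while any geodesic extends to one between mutually
    maximally distant vertices and each endpoint of the extension resolves the
    original pair.  This is [strong_resolvingP]; it turns the strong metric
    dimension into a vertex cover problem.

    In GP(n, 2) with n = 4k + 2 the distance between two vertices depends only
    on their kinds and on the cyclic distance c of their indices: it is
    min(c, ceil(c/2) + 2) between outer vertices, ceil(c/2) + 1 between an
    outer and an inner one, and c/2 or ceil(c/2) + 2 between inner ones
    according to whether c is even or odd ([gdist_GP2]).  From these formulas,
    antipodal vertices of the same kind, whose indices differ by n/2 = 2k + 1,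
    are mutually maximally distant ([antipode_maximally_distant]).  The
    antipodal pairs form a perfect matching of the 2n vertices, so every strong
    resolving set has at least n elements.

    Conversely, n/2 being odd, the outer vertices of even index together with
    the inner vertices of index less than n/2 contain exactly one vertex of
    each antipodal pair, so there are n of them, and two vertices outside this
    set are never mutually maximally distant ([GP2_cover_complement]): two
    outer ones have indices of equal parity, two inner ones are not antipodal,
    and an outer and an inner vertex are never mutually maximally distant. *)

(** * Strong resolving sets as vertex covers *)

Section ConnectedGraph.

Variables (T : finType) (e : rel T).
Hypothesis esym : symmetric e.
Hypothesis econn : forall x y, connect e x y.

Local Notation d := (gdist e).

Definition mutually_maximally_distant (x y : T) : Prop :=
  (forall z, e x z -> d z y <= d x y) /\ (forall z, e y z -> d x z <= d x y).

Lemma gdist_geodesic x y :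
  exists p, [/\ path e x p, last x p = y & size p = d x y].
Proof.
have [/existsP[p /andP[ep /eqP lp]] _] := gdistP (econn x y).
by exists p; rewrite size_tuple.
Qed.

Lemma gdist_le_size x p : path e x p -> d x (last x p) <= size p.
Proof. by move=> ep; apply: (gdistP (econn _ _)).2. Qed.

Lemma gdist_triangle y x z : d x z <= d x y + d y z.
Proof.
have [p [ep lp <-]] := gdist_geodesic x y.
have [q [eq lq <-]] := gdist_geodesic y z.
by rewrite -lq -lp -last_cat -size_cat gdist_le_size // cat_path ep lp.
Qed.

Lemma gdist_sym x y : d x y = d y x.
Proof.
suff le a b : d a b <= d b a by apply/eqP; rewrite eqn_leq !le.
have [p [ep lp <-]] := gdist_geodesic b a.
have := ep; rewrite -rev_path (eq_path (e' := e)) => [erp|u v /=]; last first.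
  exact: esym.
have := gdist_le_size erp; rewrite size_rev size_belast lp.
suff -> : last a (rev (belast b p)) = b by [].
by case: p {ep erp} lp => [<-|z p _] //=; rewrite rev_cons last_rcons.
Qed.

Lemma gdistxx x : d x x = 0.
Proof. by apply/eqP; rewrite -leqn0; apply: (@gdist_le_size x [::]). Qed.

Lemma gdist_gt0 x y : x != y -> 0 < d x y.
Proof. by case: (gdist_geodesic x y) => -[|z p] [_ /= <- <-]; rewrite ?eqxx. Qed.

Lemma gdist_edge x y : e x y -> d x y <= 1.
Proof. by move=> exy; apply: (@gdist_le_size x [:: y]); rewrite /= exy. Qed.

Lemma gdist_step x y : x != y -> exists2 z, e x z & (d z y).+1 = d x y.
Proof.
move=> nxy; have := gdist_gt0 nxy.
have [[|z p] /= [ep lp dxy]] := gdist_geodesic x y; first by rewrite -dxy.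
have /andP[exz ezp] := ep => _; exists z => //; apply/eqP.
rewrite eqn_leq -{1}dxy ltnS -{1}lp gdist_le_size //=.
by have := gdist_triangle z x y; have := gdist_edge exz; lia.
Qed.

Lemma on_shortest_pathE x y z :
  on_shortest_path e x y z = (d x z == d x y + d y z).
Proof.
apply/existsP/eqP => [[p /and3P[ep /eqP lp yp]]|dxz].
  apply/eqP; rewrite eqn_leq gdist_triangle /= -[leqRHS](size_tuple p).
  case/splitPl: yp ep lp => q r lq; rewrite cat_path last_cat lq => /andP[eq er].
  move=> lr; rewrite size_cat; have := gdist_le_size eq.
  by have := gdist_le_size er; rewrite lq lr; lia.
have [p [ep lp sp]] := gdist_geodesic x y.
have [q [eq lq sq]] := gdist_geodesic y z.
have spq : size (p ++ q) == d x z by rewrite size_cat sp sq dxz.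
exists (Tuple spq); rewrite /= cat_path last_cat lp ep eq lq eqxx /=.
by rewrite -cat_cons mem_cat -lp mem_last.
Qed.

(** A resolver [w] of the pair lies beyond one of its vertices; if it were not
    that vertex itself, the next step towards [w] would lead farther from
    the other vertex. *)
Lemma maximally_distant_cover (S : {set T}) x y :
  strong_resolving_set e S -> x != y -> mutually_maximally_distant x y ->
  (x \in S) || (y \in S).
Proof.
move=> /forallP/(_ x)/forallP/(_ y)/implyP Sxy nxy [maxx maxy].
have /exists_inP[w Sw] := Sxy nxy.
rewrite /strongly_resolves !on_shortest_pathE => /orP[]/eqP dw.
  have [->|nxw] := eqVneq x w; first by rewrite Sw.
  have [z exz dz] := gdist_step nxw; have := maxx z exz.
  by have := gdist_triangle z y w; rewrite !(gdist_sym y) in dw *; lia.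
have [->|nyw] := eqVneq y w; first by rewrite Sw orbT.
have [z eyz dz] := gdist_step nyw; have := maxy z eyz.
by have := gdist_triangle z x w; lia.
Qed.

(** A longest geodesic through [x] and [y] cannot be prolonged, so its ends
    are mutually maximally distant. *)
Lemma geodesic_extension x y : exists x' y',
  d x' y' = d x' x + d x y + d y y' /\ mutually_maximally_distant x' y'.
Proof.
pose through (p : T * T) := d p.1 p.2 == d p.1 x + d x y + d y p.2.
have : through (x, y) by rewrite /through /= !gdistxx addn0.
case/(arg_maxnP (fun p => d p.1 p.2)) => -[x' y'] /= /eqP /= dxy' maxd.
exists x', y'; split=> //; split=> z ez; rewrite leqNgt; apply/negP => ltz.
  have thr : through (z, y').
    rewrite /through /=; have := gdist_edge ez; rewrite (gdist_sym x' z).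
    have := gdist_triangle x' z x; have := gdist_triangle x z y'.
    by have := gdist_triangle y x y'; lia.
  by have /= := maxd _ thr; lia.
have thr : through (x', z).
  rewrite /through /=; have := gdist_edge ez.
  have := gdist_triangle y' y z; have := gdist_triangle x x' z.
  by have := gdist_triangle y x z; lia.
by have /= := maxd _ thr; lia.
Qed.

Lemma strong_resolvingP (S : {set T}) :
  strong_resolving_set e S <->
  (forall x y, x != y -> mutually_maximally_distant x y ->
    (x \in S) || (y \in S)).
Proof.
split=> [resS x y|coverS]; first exact: maximally_distant_cover.
apply/forallP => x; apply/forallP => y; apply/implyP => nxy.
have [x' [y' [dxy' md]]] := geodesic_extension x y.
have dxy_gt0 := gdist_gt0 nxy.
have nxy' : x' != y'.
  by apply/eqP => exy; rewrite exy gdistxx in dxy'; lia.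
apply/exists_inP; have /orP[Sx'|Sy'] := coverS _ _ nxy' md.
  exists x' => //; rewrite /strongly_resolves !on_shortest_pathE.
  apply/orP; left; rewrite !(gdist_sym _ x') (gdist_sym y x).
  by have := gdist_triangle y x' y'; have := gdist_triangle x x' y; lia.
exists y' => //; rewrite /strongly_resolves !on_shortest_pathE.
apply/orP; right.
by have := gdist_triangle x x' y'; have := gdist_triangle y x y'; lia.
Qed.

(** A candidate distance function is the distance once it is 1-Lipschitz along
    edges and every vertex other than the target has a neighbour where it
    is smaller. *)
Lemma gdist_unique (D : T -> T -> nat) :
    (forall x, D x x = 0) ->
    (forall x z y, e x z -> D x y <= (D z y).+1) ->
    (forall x y, x != y -> exists2 z, e x z & D z y < D x y) ->
  forall x y, d x y = D x y.
Proof.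
move=> D0 lipD descD x y; apply/eqP; rewrite eqn_leq; apply/andP; split.
  have [n] := ubnP (D x y); elim: n x => // n IHn x; rewrite ltnS => leD.
  have [->|/descD[z exz ltD]] := eqVneq x y; first by rewrite gdistxx.
  have := IHn z (leq_trans ltD leD); have := gdist_triangle z x y.
  by have := gdist_edge exz; lia.
have [p [ep <- <-]] := gdist_geodesic x y.
elim: p x ep => [|z p IHp] x /=; first by rewrite D0.
by case/andP=> exz /IHp; have := lipD x z (last z p) exz; lia.
Qed.

(** The pairs {x, s x} partition the vertices.  A strong resolving set meets
    each of them, and [S] is optimal because it meets each exactly once. *)
Lemma sdim_involution (s : T -> T) (S : {set T}) :
    involutive s ->
    (forall x, s x != x /\ mutually_maximally_distant x (s x)) ->
    (forall x, (s x \in S) = (x \notin S)) ->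
    (forall x y, x \notin S -> y \notin S -> x != y ->
      ~ mutually_maximally_distant x y) ->
  (sdim e).*2 = #|T|.
Proof.
move=> sK mds sS indepS.
have card_s (A : {set T}) : #|s @^-1: A| = #|A|.
  by apply: on_card_preimset; exists s => x _; rewrite sK.
have [[R resR <-] minR] := sdimP econn.
apply/eqP; rewrite eqn_leq; apply/andP; split.
  have resS : strong_resolving_set e S.
    apply/strong_resolvingP => x y nxy md.
    by apply/negPn/negP; rewrite negb_or => /andP[/indepS H /H/(_ nxy)].
  have <- : #|S| + #|~: S| = #|T| by rewrite cardsC.
  have -> : ~: S = s @^-1: S by apply/setP => x; rewrite !inE sS.
  by rewrite card_s addnn leq_double; apply: minR.
rewrite -cardsT -addnn -[X in _ <= _ + X]card_s.
apply: leq_trans (leq_card_setU _ _); apply: subset_leq_card.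
apply/subsetP => x _; rewrite !inE; have [nsx md] := mds x.
by apply: maximally_distant_cover => //; rewrite eq_sym.
Qed.

End ConnectedGraph.

(** * Distances in GP(4k + 2, 2) *)

Section PetersenTwo.

Variable k : nat.

Local Notation n := (4 * k + 2).
Local Notation V := ('I_n + 'I_n)%type.

Definition cycle_dist (i j : nat) : nat :=
  let a := (i - j) + (j - i) in minn a (n - a).

(** For indices below n and m <= n this says that i and j differ by m modulo n;
    spelling out the wrap-around keeps it within linear arithmetic. *)
Definition cycle_adj (m i j : nat) : bool :=
  [|| j == i + m, j + n == i + m, i == j + m | i + n == j + m].

Lemma eq_modn_add m (i j : 'I_n) : m <= n ->
  (val j == (i + m) %% n) = (val j == i + m) || (val j + n == i + m).
Proof.
move=> le_mn; have := ltn_ord i; have := ltn_ord j => /= ltj lti.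
have [lt|le] := ltnP (i + m) n; first by rewrite modn_small //; lia.
rewrite -[in LHS](subnK le) modnDr modn_small; lia.
Qed.

Definition GP2_adj (x y : V) : bool :=
  match x, y with
  | inl i, inl j => cycle_adj 1 i j
  | inr i, inr j => cycle_adj 2 i j
  | inl i, inr j | inr i, inl j => val i == val j
  end.

Lemma GP2E x y : GP n 2 x y = GP2_adj x y.
Proof.
case: x => i; case: y => j; rewrite /GP /=.
- by rewrite !eq_modn_add /= /cycle_adj; lia.
- by rewrite orbF.
- by rewrite eq_sym.
- by rewrite !eq_modn_add /= /cycle_adj; lia.
Qed.

Definition GP2_dist (x y : V) : nat :=
  match x, y with
  | inl i, inl j => let c := cycle_dist i j in minn c (uphalf c).+2
  | inr i, inr j =>
      let c := cycle_dist i j in if odd c then (uphalf c).+2 else c./2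
  | inl i, inr j | inr i, inl j => (uphalf (cycle_dist i j)).+1
  end.

Lemma cycle_step_towards m (i j : 'I_n) : m <= cycle_dist i j ->
  exists2 i' : 'I_n, cycle_adj m i i' & cycle_dist i' j + m = cycle_dist i j.
Proof.
move=> le_m; have := ltn_ord i; have := ltn_ord j => ltj lti.
suff [i' [lt_i']] : exists i', [/\ i' < n, cycle_adj m i i'
    & cycle_dist i' j + m = cycle_dist i j] by exists (Ordinal lt_i').
rewrite /cycle_dist /cycle_adj in le_m *.
have [leij|ltji] := leqP i j.
  have [lec|gtc] := leqP (j - i) (2 * k + 1).
    by exists (i + m); split; lia.
  have [lem|gtm] := leqP m i; first by exists (i - m); split; lia.
  by exists (i + n - m); split; lia.
have [lec|gtc] := leqP (i - j) (2 * k + 1).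
  by exists (i - m); split; lia.
have [lem|gtm] := ltnP (i + m) n; first by exists (i + m); split; lia.
by exists (i + m - n); split; lia.
Qed.

Lemma cycle_step_away m (i j : 'I_n) : cycle_dist i j + m <= 2 * k + 1 ->
  exists2 i' : 'I_n, cycle_adj m i i' & cycle_dist i' j = cycle_dist i j + m.
Proof.
move=> le_m; have := ltn_ord i; have := ltn_ord j => ltj lti.
suff [i' [lt_i']] : exists i', [/\ i' < n, cycle_adj m i i'
    & cycle_dist i' j = cycle_dist i j + m] by exists (Ordinal lt_i').
rewrite /cycle_dist /cycle_adj in le_m *.
have [lec|gtc] := leqP i j.
  have [lec'|gtc'] := leqP (j - i) (2 * k + 1).
    have [lem|gtm] := leqP m i; first by exists (i - m); split; lia.
    by exists (i + n - m); split; lia.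
  by exists (i + m); split; lia.
have [lec'|gtc'] := leqP (i - j) (2 * k + 1).
  have [lem|gtm] := ltnP (i + m) n; first by exists (i + m); split; lia.
  by exists (i + m - n); split; lia.
by exists (i - m); split; lia.
Qed.

Lemma cycle_dist_lipschitz m (i i' j : 'I_n) :
  cycle_adj m i i' -> cycle_dist i j <= cycle_dist i' j + m.
Proof.
have := ltn_ord i; have := ltn_ord j; have := ltn_ord i'.
by rewrite /cycle_adj /cycle_dist; lia.
Qed.

Lemma odd_cycle_dist (i j : 'I_n) : odd (cycle_dist i j) = odd i (+) odd j.
Proof.
have := ltn_ord i; have := ltn_ord j.
by rewrite /cycle_dist; lia.
Qed.

Lemma cycle_distC i j : cycle_dist i j = cycle_dist j i.
Proof. by rewrite /cycle_dist addnC. Qed.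

Lemma cycle_dist_le (i j : 'I_n) : cycle_dist i j <= 2 * k + 1.
Proof. by rewrite /cycle_dist; lia. Qed.

Lemma GP2_distC x y : GP2_dist x y = GP2_dist y x.
Proof. by case: x => i; case: y => j /=; rewrite cycle_distC. Qed.

Lemma cycle_dist0 (i j : 'I_n) : cycle_dist i j = 0 -> i = j.
Proof.
have := ltn_ord i; have := ltn_ord j; rewrite /cycle_dist => ltj lti d0.
by apply: val_inj => /=; lia.
Qed.

Lemma GP2_dist_lipschitz x z y :
  GP2_adj x z -> GP2_dist x y <= (GP2_dist z y).+1.
Proof.
case: x => i; case: z => i'; case: y => j /=;
  try by move=> /eqP->; try case: ifP; lia.
- by move=> a; have := @cycle_dist_lipschitz 1 i i' j a; lia.
- by move=> a; have := @cycle_dist_lipschitz 1 i i' j a; lia.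
- by move=> a; have := @cycle_dist_lipschitz 2 i i' j a; lia.
move=> a; have := @cycle_dist_lipschitz 2 i i' j a.
have -> : odd (cycle_dist i j) = odd (cycle_dist i' j).
  rewrite !odd_cycle_dist; have := ltn_ord i; have := ltn_ord i'.
  by move: a; rewrite /cycle_adj; lia.
by case: ifP; lia.
Qed.

(** Between outer vertices the outer rim is a shortest route up to cyclic
    distance 4, and a detour along an inner cycle is one from 5 on.  Inner
    edges preserve the parity of the index, so when c is odd a route must also
    use an outer edge. *)
Lemma GP2_dist_descent x y : x != y ->
  exists2 z, GP2_adj x z & GP2_dist z y < GP2_dist x y.
Proof.
case: x => i; case: y => j nxy.
- have [le4|gt4] := leqP (cycle_dist i j) 4; last first.
    by exists (inr i) => //=; lia.
  have c_gt0 : 0 < cycle_dist i j.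
    by rewrite lt0n; apply: contra nxy => /eqP/cycle_dist0->.
  have [i' adj di'] := cycle_step_towards c_gt0.
  by exists (inl i') => //=; lia.
- have [odd_c|even_c] := boolP (odd (cycle_dist i j)).
    have c_gt0 : 0 < cycle_dist i j by lia.
    have [i' adj di'] := cycle_step_towards c_gt0.
    by exists (inl i') => //=; lia.
  by exists (inr i) => //=; rewrite (negPf even_c); lia.
- have [ge2|lt2] := leqP 2 (cycle_dist i j).
    have [i' adj di'] := cycle_step_towards ge2.
    by exists (inr i') => //=; lia.
  by exists (inl i) => //=; lia.
- have [odd_c|even_c] := boolP (odd (cycle_dist i j)).
    by exists (inl i) => //=; rewrite odd_c; lia.
  have c_gt0 : 0 < cycle_dist i j.
    by rewrite lt0n; apply: contra nxy => /eqP/cycle_dist0->.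
  have ge2 : 2 <= cycle_dist i j by lia.
  have [i' adj di'] := cycle_step_towards ge2.
  by exists (inr i') => //=; case: ifP; case: ifP; lia.
Qed.

Lemma gdist_GP2 x y : gdist (GP n 2) x y = GP2_dist x y.
Proof.
apply: gdist_unique; first exact: GP_connected.
- by case=> i /=; rewrite /cycle_dist subnn min0n.
- by move=> u z w; rewrite GP2E; apply: GP2_dist_lipschitz.
move=> u w /GP2_dist_descent[z adj ltz].
by exists z; rewrite ?GP2E.
Qed.

(** * Antipodal vertices and a minimum strong resolving set *)

Definition half_turn (i : nat) : nat :=
  if i < 2 * k + 1 then i + (2 * k + 1) else i - (2 * k + 1).

Lemma half_turn_lt (i : 'I_n) : half_turn i < n.
Proof. by have := ltn_ord i; rewrite /half_turn; case: ifP; lia. Qed.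

Definition antipode (x : V) : V :=
  match x with
  | inl i => inl (Ordinal (half_turn_lt i))
  | inr i => inr (Ordinal (half_turn_lt i))
  end.

Lemma antipodeK : involutive antipode.
Proof.
suff htK (i : 'I_n) : half_turn (half_turn i) = i.
  by case=> i /=; [congr inl | congr inr]; apply: val_inj; apply: htK.
by have := ltn_ord i; rewrite /half_turn; do 2 case: ifP; lia.
Qed.

Lemma cycle_dist_half_turn (i : 'I_n) : cycle_dist i (half_turn i) = 2 * k + 1.
Proof.
by have := ltn_ord i; rewrite /cycle_dist /half_turn; case: ifP; lia.
Qed.

(** Antipodal indices have the largest cyclic distance, and it is odd, which is
    the expensive parity for inner vertices.  For outer ones, moving to the
    inner side changes the distance to k + 2, and this is at most 2k + 1
    because k is positive. *)
Lemma GP2_dist_antipode_max x y : 0 < k -> GP2_adj x y ->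
  GP2_dist y (antipode x) <= GP2_dist x (antipode x).
Proof.
case: x => i; case: y => j /=; rewrite cycle_dist_half_turn => k_gt0 adj.
- by have := cycle_dist_le j (Ordinal (half_turn_lt i)) => /=; lia.
- by rewrite -(eqP adj) cycle_dist_half_turn; lia.
- by rewrite -(eqP adj) cycle_dist_half_turn; case: ifP; lia.
by have := cycle_dist_le j (Ordinal (half_turn_lt i)) => /=; do 2 case: ifP; lia.
Qed.

Lemma antipode_maximally_distant x :
  0 < k -> mutually_maximally_distant (GP n 2) x (antipode x).
Proof.
move=> k_gt0; split=> z; rewrite GP2E !gdist_GP2.
  exact: GP2_dist_antipode_max.
move=> adj; have := GP2_dist_antipode_max k_gt0 adj.
by rewrite antipodeK GP2_distC [GP2_dist (antipode x) x]GP2_distC.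
Qed.

Lemma antipode_neq x : antipode x != x.
Proof.
suff ht (i : 'I_n) : half_turn i = i -> False.
  by case: x => i; apply/eqP => -[] /(congr1 val); apply: ht.
by rewrite /half_turn; case: ifP; lia.
Qed.

Definition GP2_cover : {set V} :=
  [set x : V | match x with inl i => ~~ odd i | inr i => i < 2 * k + 1 end].

Lemma antipode_cover x : (antipode x \in GP2_cover) = (x \notin GP2_cover).
Proof.
by case: x => i; have := ltn_ord i; rewrite !inE /= /half_turn; case: ifP; lia.
Qed.

Lemma not_maximally_distant x y z :
  GP2_adj x z -> GP2_dist x y < GP2_dist z y ->
  ~ mutually_maximally_distant (GP n 2) x y.
Proof.
move=> adj lt [maxx _].
by have := maxx z; rewrite GP2E !gdist_GP2 leqNgt lt => /(_ adj).
Qed.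

Lemma maximally_distantC x y :
  mutually_maximally_distant (GP n 2) x y ->
  mutually_maximally_distant (GP n 2) y x.
Proof.
have gC := gdist_sym (@GP_sym n 2) (@GP_connected n 2).
by case=> maxx maxy; split=> z; rewrite gC (gC y); [apply: maxy | apply: maxx].
Qed.

(** Raising an even c by one raises ceil(c/2), so the outer vertex can retreat
    along its rim; for odd c its spoke leads away, to an inner vertex of the
    parity opposite to that of the target. *)
Lemma outer_inner_not_maximally_distant (i j : 'I_n) :
  ~ mutually_maximally_distant (GP n 2) (inl i) (inr j).
Proof.
have := cycle_dist_le i j => lec.
have [odd_c|even_c] := boolP (odd (cycle_dist i j)).
  by apply: (@not_maximally_distant _ _ (inr i)) => //=; rewrite odd_c; lia.
have le1 : cycle_dist i j + 1 <= 2 * k + 1 by lia.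
have [i' adj di'] := cycle_step_away le1.
by apply: (@not_maximally_distant _ _ (inl i')) => //=; lia.
Qed.

(** The cover is chosen so that outside it neither kind of pair can be
    antipodal: c is even, hence not 2k + 1, for outer vertices and less than
    2k + 1 for inner ones, which leaves room to retreat along a rim.  Inner
    vertices may already be at cyclic distance 2k, where an inner edge gains
    nothing; for even c their way to retreat is the spoke. *)
Lemma GP2_cover_complement x y : x \notin GP2_cover -> y \notin GP2_cover ->
  x != y -> ~ mutually_maximally_distant (GP n 2) x y.
Proof.
case: x => i; case: y => j; rewrite !inE => Ci Cj _.
- have even_c : odd (cycle_dist i j) = false by rewrite odd_cycle_dist; lia.
  have le1 : cycle_dist i j + 1 <= 2 * k + 1.
    by have := cycle_dist_le i j; lia.
  have [i' adj di'] := cycle_step_away le1.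
  by apply: (@not_maximally_distant _ _ (inl i')) => //=; lia.
- exact: outer_inner_not_maximally_distant.
- by move/maximally_distantC; apply: outer_inner_not_maximally_distant.
have lec : cycle_dist i j <= 2 * k.
  by have := ltn_ord i; have := ltn_ord j; rewrite /cycle_dist; lia.
have [odd_c|even_c] := boolP (odd (cycle_dist i j)).
  have le2 : cycle_dist i j + 2 <= 2 * k + 1 by lia.
  have [i' adj di'] := cycle_step_away le2.
  by apply: (@not_maximally_distant _ _ (inr i')) => //=; do 2 case: ifP; lia.
apply: (@not_maximally_distant _ _ (inl i)) => //=.
by rewrite (negPf even_c); lia.
Qed.

End PetersenTwo.

Theorem theorem1 (k : nat) (hk : 1 <= k) :
  sdim (GP (4 * k + 2) 2) = 4 * k + 2.
Proof.
apply: double_inj.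
rewrite (@sdim_involution _ _ (@GP_sym _ _) (@GP_connected _ _)
  (@antipode k) (GP2_cover k)).
- by rewrite card_sum card_ord addnn.
- exact: antipodeK.
- by move=> x; split; [apply: antipode_neq | apply: antipode_maximally_distant].
- exact: antipode_cover.
- exact: GP2_cover_complement.
Qed.
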